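(* Every affine equivariant numerical integrator $\Phi$ is closed under differentiation. That is, for every Banach space $Y$ and $f\in\mathfrak{X}(Y)$, applying $\Phi$ to the system $\dot y=f(y)$, $\dot\eta=f'(y)\eta$ on $Y\times Y$ with initial value $(y_0,\eta_0)$ yields $(y_1,\eta_1)=\bigl(\Phi_f(y_0),\Phi_f'(y_0)\eta_0\bigr)$.
   Context: For a Banach space $Y$, $\mathfrak{X}(Y)$ denotes the vector fields on $Y$, viewed as maps $f\colon Y\to Y$. A numerical integrator is a collection of maps $\Phi=\{\Phi_f\colon Y\to Y \mid f\in\mathfrak{X}(Y),\ Y\text{ a Banach space}\}$, where $\Phi_f\colon y_0\mapsto y_1$ is one step with unit time step. Regularity is left implicit: vector fields, and the dependence of $\Phi_f(y)$ on its data, are taken regular enough that all derivatives written make sense. For an affine map $A\colon Y\to U$ with derivative (linear part) $A'$, vector fields $f\in\mathfrak{X}(Y)$ and $g\in\mathfrak{X}(U)$ are $A$-related if $A'\circ f=g\circ A$. $\Phi$ is affine equivariant if $A\circ\Phi_f=\Phi_g\circ A$ for all $A$-related $f,g$, all affine maps $A\colon Y\to U$, and all Banach spaces $Y,U$. *)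

(* Defs.v *)
From HB Require Import structures.
From mathcomp Require Import all_boot all_order all_algebra.
From mathcomp Require Import all_classical all_reals all_analysis.

Set Implicit Arguments.
Unset Strict Implicit.
Unset Printing Implicit Defensive.

Import Order.TTheory GRing.Theory Num.Theory.
Import numFieldNormedType.Exports.

Local Open Scope classical_set_scope.
Local Open Scope ring_scope.

(* MathComp-Analysis has no completeness instance for binary products; it is
   needed for [Y * Y] to be a Banach space. *)
HB.instance Definition _ (T U : puniformType) := Uniform.on (T * U)%type.

Lemma prod_complete (T U : completeType) (F : set_system (T * U)%type) :
  ProperFilter F -> cauchy F -> cvg F.
Proof.
move=> FF Fc.
have c1 : cauchy (fst @ F).
  move=> A entA.
  have := Fc [set p | A (p.1.1, p.2.1)].
  rewrite !nbhs_simpl /= => H.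
  have entA' : entourage [set p : (T * U) * (T * U) | A (p.1.1, p.2.1)].
    exists (A, setT); first by split => //=; exact: entourageT.
    by move=> [[a b] [c d]] [/= Aac _]; exists ((a, c), (b, d)).
  have [[P Q] /= [FP FQ] PQ] := H entA'.
  exists (fst @` P, fst @` Q).
    split; [apply: (@filterS _ F _ P) => // x Px|
            apply: (@filterS _ F _ Q) => // x Px]; by exists x.
  by move=> [a b] [/= [x Px <-] [y Qy <-]]; exact: (PQ (x, y)).
have c2 : cauchy (snd @ F).
  move=> A entA.
  have := Fc [set p | A (p.1.2, p.2.2)].
  rewrite !nbhs_simpl /= => H.
  have entA' : entourage [set p : (T * U) * (T * U) | A (p.1.2, p.2.2)].
    exists (setT, A); first by split => //=; exact: entourageT.
    by move=> [[a b] [c d]] [/= _ Abd]; exists ((a, c), (b, d)).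
  have [[P Q] /= [FP FQ] PQ] := H entA'.
  exists (snd @` P, snd @` Q).
    split; [apply: (@filterS _ F _ P) => // x Px|
            apply: (@filterS _ F _ Q) => // x Px]; by exists x.
  by move=> [a b] [/= [x Px <-] [y Qy <-]]; exact: (PQ (x, y)).
have /cauchy_cvg /cvg_ex[a Fa] := c1.
have /cauchy_cvg /cvg_ex[b Fb] := c2.
apply/cvg_ex; exists (a, b) => A [[P Q] [/= aP bQ] PQA].
apply: (@filterS _ F _ ((fst @^-1` P) `&` (snd @^-1` Q))).
  by move=> [x y] [/= Px Qy]; exact: PQA.
by apply: filterI; [exact: Fa | exact: Fb].
Qed.

HB.instance Definition _ (T U : completeType) :=
  Uniform_isComplete.Build (T * U)%type (@prod_complete T U).

HB.instance Definition _ (R : numFieldType) (Y U : completeNormedModType R) :=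
  Complete.on (Y * U)%type.

(* [f] is C^0 if it is continuous, and C^(n+1) if it is Frechet differentiable
   and [(y, v) |-> f'(y) v] is C^n on [Y * Y].  For a fixed [n] this asks only
   for joint (not operator-norm) continuity of the derivatives, but being C^n
   for all [n] is the usual Frechet smoothness of maps of normed spaces. *)
Fixpoint Ck (R : realType) (n : nat) (Y U : normedModType R) (f : Y -> U) :
    Prop :=
  if n is n'.+1 then
    (forall y, differentiable f y) /\
    Ck n' (fun p : (Y * Y)%type => 'd f (p.1) p.2)
  else continuous f.

Definition smooth (R : realType) (Y U : normedModType R) (f : Y -> U) : Prop :=
  forall n, Ck n f.

Record vector_field (R : realType) (Y : completeNormedModType R) :=
  VectorField { field_fun :> Y -> Y ; field_smooth : smooth field_fun }.

Lemma Ck_comp_linear (R : realType) (n : nat) (Y U V : normedModType R)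
    (f : U -> V) (L : {linear Y -> U}) :
  continuous L -> Ck n f -> Ck n (f \o L).
Proof.
elim: n Y U V f L => [|n IHn] Y U V f L Lc /=.
  by move=> fc y; apply: continuous_comp; [exact: Lc|exact: fc].
move=> [fd Cf]; have Ld y : differentiable L y by exact: linear_differentiable.
split; first by move=> y; exact: differentiable_comp.
pose LL (p : (Y * Y)%type) : (U * U)%type := (L p.1, L p.2).
have LLlin : linear LL.
  by move=> a [x1 x2] [y1 y2]; rewrite /LL /= !linearP.
pose HLL := GRing.isLinear.Build R (Y * Y)%type (U * U)%type *:%R LL LLlin.
pose LLL : {linear (Y * Y)%type -> (U * U)%type} := HB.pack LL HLL.
have LLc : continuous LLL.
  move=> p; apply: cvg_pair; apply: continuous_comp.
  - exact: cvg_fst.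
  - exact: Lc.
  - exact: cvg_snd.
  - exact: Lc.
suff -> : (fun p : (Y * Y)%type => 'd (f \o L) (p.1) p.2) =
          (fun p : (U * U)%type => 'd f (p.1) p.2) \o LLL by exact: IHn.
by apply/funext => p; rewrite /= diff_comp //= diff_lin.
Qed.

Lemma Ck_pair (R : realType) (n : nat) (Y U V : normedModType R)
    (f : Y -> U) (g : Y -> V) :
  Ck n f -> Ck n g -> Ck n (fun y => (f y, g y)).
Proof.
elim: n Y U V f g => [|n IHn] Y U V f g /=.
  by move=> fc gc y; apply: cvg_pair; [exact: fc|exact: gc].
move=> [fd Cf] [gd Cg]; split; first by move=> y; exact: differentiable_pair.
suff -> : (fun p : (Y * Y)%type => 'd (fun y => (f y, g y)) (p.1) p.2) =
          (fun p => ('d f (p.1) p.2, 'd g (p.1) p.2)) by exact: IHn.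
by apply/funext => p; rewrite diff_pair.
Qed.

Lemma tangent_smooth (R : realType) (Y : completeNormedModType R)
    (f : vector_field Y) :
  smooth (fun p : (Y * Y)%type => (f p.1, 'd f (p.1) p.2)).
Proof.
move=> n; apply: Ck_pair; last by have [] := field_smooth f n.+1.
by apply: (@Ck_comp_linear _ _ _ _ _ f fst);
  [move=> p; exact: cvg_fst | exact: field_smooth].
Qed.

(* The system y' = f(y), eta' = f'(y) eta on [Y * Y]. *)
Definition tangent_field (R : realType) (Y : completeNormedModType R)
    (f : vector_field Y) : vector_field (Y * Y)%type :=
  VectorField (tangent_smooth f).

(* The linear part is the derivative of the affine map, hence bounded. *)
Record affine_map (R : realType) (Y U : completeNormedModType R) := AffineMap {
  linear_part : {linear Y -> U} ;
  translation_part : U ;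
  linear_part_continuous : continuous linear_part }.

Definition affine_fun (R : realType) (Y U : completeNormedModType R)
    (A : affine_map Y U) (y : Y) : U := linear_part A y + translation_part A.

Coercion affine_fun : affine_map >-> Funclass.

Definition related (R : realType) (Y U : completeNormedModType R)
    (A : affine_map Y U) (f : vector_field Y) (g : vector_field U) : Prop :=
  linear_part A \o f = g \o A.

Definition integrator (R : realType) : Type :=
  forall Y : completeNormedModType R, vector_field Y -> Y -> Y.

Definition affine_equivariant (R : realType) (Phi : integrator R) : Prop :=
  forall (Y U : completeNormedModType R) (A : affine_map Y U)
    (f : vector_field Y) (g : vector_field U),
    related A f g -> A \o Phi Y f = Phi U g \o A.

Definition closed_under_differentiation (R : realType) (Phi : integrator R) :
    Prop :=
  forall (Y : completeNormedModType R) (f : vector_field Y) (y0 eta0 : Y),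
    Phi (Y * Y)%type (tangent_field f) (y0, eta0) =
      (Phi Y f y0, 'd (Phi Y f) y0 eta0).

(* Main.v *)
(** The difference quotient and the derivative of [f] fit into one smooth
    vector field on [Y * Y * R],
      F((y, eta), t) = ((f y, q(y, eta, t)), 0),
    with q = (f (y + t eta) - f y) / t for t != 0 and q = f'(y) eta for t = 0.
    Each slice t = const is affinely embedded, and the slice t = 0 is the
    tangent field.  On a slice t != 0 both (y, eta) |-> y and
    (y, eta) |-> y + t eta are affine relations with [f], so there
    Phi_F((y, eta), t) = ((Phi_f y, (Phi_f (y + t eta) - Phi_f y) / t), t).
    Since Phi_F is differentiable, hence continuous, letting t tend to 0
    identifies the slice t = 0 with (Phi_f y, Phi_f'(y) eta).

    The smoothness of q is proved without integration.  The Taylor quotients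
      Q_k[G](x, t) = (G(x, t) - sum_(j < k) t^j c_j(x)) / t^k,
      c_j(x) = (d/dt)^j G(x, 0) / j!,
    extended by c_k at t = 0, are continuous by the mean value inequality, and
    Q_k[G] = c_k + t Q_(k+1)[G] makes them differentiable at t = 0; their
    derivatives are
      dQ_k[G](x, t)(v, s) = Q_k[dx G]((x, v), t)
        + s (Q_k[dt G] - k Q_(k+1)[G])(x, t),
    again combinations of Taylor quotients of smooth maps. *)

Require Import Defs.
From HB Require Import structures.
From mathcomp Require Import all_boot all_order all_algebra.
From mathcomp Require Import all_classical all_reals all_analysis.

Set Implicit Arguments.
Unset Strict Implicit.
Unset Printing Implicit Defensive.

Import Order.TTheory GRing.Theory Num.Theory.
Import numFieldNormedType.Exports.

Local Open Scope classical_set_scope.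
Local Open Scope ring_scope.

(** * Frechet derivatives and the mean value inequality *)

Lemma is_diff_linear (R : realType) (V W : normedModType R) (f : V -> W)
    (x : V) :
  linear f -> continuous f -> is_diff x f f.
Proof.
move=> flin fc.
pose Hf := GRing.isLinear.Build R V W *:%R f flin.
pose F : {linear V -> W} := HB.pack f Hf.
have dF : is_diff x (F : V -> W) F.
  by apply: DiffDef; [exact: linear_differentiable|exact: diff_lin].
exact: dF.
Qed.

Lemma is_diff_bound (R : realType) (V W : normedModType R) (f df : V -> W)
    (x : V) (e : R) :
  is_diff x f df -> 0 < e ->
  \forall h \near (0 : V), `|f (x + h) - f x - df h| <= e * `|h|.
Proof.
move=> dfx e0; have fx : differentiable f x by exact: ex_diff.
have /diff_locally/eqaddoP/(_ e e0) := fx; rewrite diff_val; apply: filterS.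
by move=> h; rewrite [x + h]addrC -addrA -opprD.
Qed.

Lemma is_diffP (R : realType) (V W : normedModType R) (f df : V -> W) (x : V) :
  linear df -> continuous df ->
  (forall e, 0 < e ->
     \forall h \near (0 : V), `|f (x + h) - f x - df h| <= e * `|h|) ->
  is_diff x f df.
Proof.
move=> dlin dc H.
pose Hd := GRing.isLinear.Build R V W *:%R df dlin.
pose D : {linear V -> W} := HB.pack df Hd.
have Ho : f \o shift x = cst (f x) + (D : V -> W) +o_ 0 id.
  apply/eqaddoP => e e0; apply: filterS (H e e0) => h hb.
  by move: hb; rewrite [x + h]addrC -addrA -opprD.
have dE : 'd f x = D :> (V -> W) by exact: diff_unique.
by apply: DiffDef => //; apply/diff_locallyP; rewrite dE.
Qed.

(** Scalar multiplication is continuous and bilinear, hence differentiable, and the product rule is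
    the chain rule through the pair [(k, f)]. *)
Lemma is_diff_scalef (R : realType) (V W : normedModType R)
    (k dk : V -> R) (f df : V -> W) (x : V) :
  is_diff x k dk -> is_diff x f df ->
  is_diff x (fun y => k y *: f y) (fun v => k x *: df v + dk v *: f x).
Proof.
move=> dkx dfx.
have sbil : bilinear_for (GRing.Scale.Law.clone _ _ *:%R _)
    (GRing.Scale.Law.clone _ _ *:%R _) (@GRing.scale R W).
  by split=> [u a b c|u a b c] /=;
    rewrite ?scalerDl ?scalerDr ?scalerA // mulrC.
pose Hs := bilinear_isBilinear.Build R R W W _ _ (@GRing.scale R W) sbil.
pose S : {bilinear R -> W -> W} := HB.pack (@GRing.scale R W) Hs.
have Sc : continuous (fun p : R * W => S p.1 p.2) by exact: scale_continuous.
have dS : is_diff (k x, f x) (fun p : R * W => S p.1 p.2)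
    (fun q => S (k x) q.2 + S q.1 (f x)).
  by apply: DiffDef; [exact: differentiable_bilin|exact: diff_bilin].
exact: (is_diff_comp (is_diff_pair dkx dfx) dS).
Qed.

Lemma is_diff_line (R : realType) (V W : normedModType R) (f : V -> W)
    (x a : V) (s : R) :
  differentiable f (x + s *: a) ->
  is_diff s (fun r : R => f (x + r *: a))
    (fun h => h *: 'd f (x + s *: a) a).
Proof.
move=> fd.
have dl : is_diff s (fun r : R => x + r *: a) (fun h => h *: a).
  apply: (is_diff_eq (is_diffD (is_diff_cst x s) (is_diff_scalel s a))).
  by apply/funext => h /=; exact: add0r.
have df : is_diff (x + s *: a) f ('d f (x + s *: a)) by exact: differentiableP.
apply: (is_diff_eq (is_diff_comp dl df)).
by apply/funext => h /=; rewrite linearZ.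
Qed.

(* If [M < M'], then [s |-> |u(1) - u(s)| + M' s] strictly increases to the
   right of every [s < 1], so it attains its maximum over [[0, 1]] at [1]. *)
Lemma mean_value_inequality (R : realType) (V : normedModType R)
    (u du : R -> V) (M : R) :
  (forall s, is_diff s u (fun h => h *: du s)) ->
  (forall s, 0 <= s <= 1 -> `|du s| <= M) ->
  `|u 1 - u 0| <= M.
Proof.
move=> ud duM; apply/ler_addgt0Pr => e e0.
pose psi s := `|u 1 - u s| + (M + e) * s.
have psic : continuous psi.
  move=> s; apply: cvgD.
    apply: cvg_norm; apply: cvgB; first exact: cvg_cst.
    by apply: differentiable_continuous; exact: (@ex_diff _ _ _ _ _ _ _ (ud s)).
  by apply: cvgM; [exact: cvg_cst|exact: cvg_id].
have [c] := @EVT_max R psi 0 1 ler01 (continuous_subspaceT psic).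
rewrite in_itv /= => /andP[c0 c1] cmax.
have [c_lt1|] := ltP c 1; last first.
  move=> c_ge1; have c1E : c = 1 by apply/eqP; rewrite eq_le c1.
  have := cmax 0; rewrite in_itv /= lexx ler01 => /(_ isT).
  by rewrite /psi c1E subrr normr0 mulr0 mulr1 addr0 add0r.
have e20 : 0 < e / 2 by rewrite divr_gt0.
have /nbhs_normP[d /= d0 dP] := is_diff_bound (ud c) e20.
(* [d / 2] keeps [h] inside the ball where the linearization error is at most [e / 2 * h]; [1 - c]
   keeps [c + h] in the interval. *)
pose h := Num.min (d / 2) (1 - c).
have h0 : 0 < h by rewrite lt_min divr_gt0 //= subr_gt0.
have hd : h < d by rewrite gt_min ltr_pdivrMr // mulr2n mulrDr mulr1 ltrDl d0.
have hc : c + h <= 1 by rewrite -lerBrDl ge_min lexx orbT.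
have := dP h; rewrite /= sub0r normrN gtr0_norm // => /(_ hd) near_c.
have /cmax : c + h \in `[0, 1]%R by rewrite in_itv /= hc addr_ge0 // ltW.
have uh : `|u (c + h) - u c| <= h * (M + e / 2).
  rewrite -[u _ - _](subrK (h *: du c)) (le_trans (ler_normD _ _)) //.
  rewrite normrZ (gtr0_norm h0) mulrDr addrC lerD //; last by rewrite mulrC.
  by rewrite ler_pM2l // duM // c0.
(* Moving from [c] to [c + h] costs at most [h * (M + e / 2)] in the norm and gains [h * (M + e)],
   against maximality at [c]. *)
rewrite /psi leNgt => /negP[].
have : `|u 1 - u c| <= `|u 1 - u (c + h)| + h * (M + e / 2).
  apply: le_trans (lerD (lexx _) uh).
  by rewrite -[u 1 - u c](subrKA (u (c + h))) ler_normD.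
move=> /le_lt_trans H; rewrite -ltrBrDr; apply: H.
rewrite -addrA ltrD2l -mulrBr addrAC subrr add0r [X in _ < X]mulrC ltr_pM2l //.
by rewrite ltrD2l ltr_pdivrMr // mulr2n mulrDr mulr1 ltrDl.
Qed.

(** * Calculus of C^n maps *)

Lemma CkS (R : realType) (n : nat) (Y U : normedModType R) (f : Y -> U) :
  Ck n.+1 f -> Ck n f.
Proof.
elim: n Y U f => [|n IHn] Y U f [fd Cf].
  by move=> y; exact: differentiable_continuous.
by split => //; exact: IHn.
Qed.

Lemma smooth_continuous (R : realType) (Y U : normedModType R) (f : Y -> U) :
  smooth f -> continuous f.
Proof. by move=> /(_ 0%N). Qed.

Lemma smooth_differentiable (R : realType) (Y U : normedModType R)
    (f : Y -> U) (y : Y) :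
  smooth f -> differentiable f y.
Proof. by move=> /(_ 1%N)[]. Qed.

Lemma smooth_diff (R : realType) (Y U : normedModType R) (f : Y -> U) :
  smooth f -> smooth (fun p : Y * Y => 'd f (p.1) p.2).
Proof. by move=> sf n; have [] := sf n.+1. Qed.

Lemma Ck_linear (R : realType) (n : nat) (Y U : normedModType R) (f : Y -> U) :
  linear f -> continuous f -> Ck n f.
Proof.
elim: n Y U f => [|n IHn] Y U f flin fc //.
have fd y := is_diff_linear y flin fc.
split; first by move=> y; exact: (@ex_diff _ _ _ _ _ _ _ (fd y)).
have -> : (fun p : Y * Y => 'd f (p.1) p.2) = f \o snd.
  by apply/funext => p; rewrite (@diff_val _ _ _ _ _ _ _ (fd p.1)).
apply: IHn; first by move=> a p q; exact: flin.
by move=> p; apply: continuous_comp; [exact: cvg_snd|exact: fc].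
Qed.

Lemma Ck_fst (R : realType) (n : nat) (Y U : normedModType R) :
  Ck n (fst : Y * U -> Y).
Proof. by apply: Ck_linear => // p; exact: cvg_fst. Qed.

Lemma Ck_snd (R : realType) (n : nat) (Y U : normedModType R) :
  Ck n (snd : Y * U -> U).
Proof. by apply: Ck_linear => // p; exact: cvg_snd. Qed.

Lemma Ck_cst (R : realType) (n : nat) (Y U : normedModType R) (c : U) :
  Ck n (fun _ : Y => c).
Proof.
elim: n Y U c => [|n IHn] Y U c; first by move=> y; exact: cvg_cst.
split; first by move=> y; exact: differentiable_cst.
have -> : (fun p : Y * Y => 'd (fun _ : Y => c) (p.1) p.2) = fun=> 0.
  by apply/funext => p; rewrite diff_cst.
exact: IHn.
Qed.

(** By the chain rule the derivative map is again a composition, with inner map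
    [(g p.1, 'd g p.1 p.2)]; its first component is C^n because C^(n+1) implies C^n. *)
Lemma Ck_comp (R : realType) (n : nat) (Y U V : normedModType R)
    (f : U -> V) (g : Y -> U) :
  Ck n f -> Ck n g -> Ck n (f \o g).
Proof.
elim: n Y U V f g => [|n IHn] Y U V f g.
  by move=> fc gc y; apply: continuous_comp; [exact: gc|exact: fc].
move=> [fd Cf] Cg; have [gd Cdg] := Cg.
split; first by move=> y; exact: differentiable_comp.
have -> : (fun p : Y * Y => 'd (f \o g) (p.1) p.2) =
    (fun q : U * U => 'd f (q.1) q.2) \o (fun p => (g p.1, 'd g (p.1) p.2)).
  by apply/funext => p; rewrite /= diff_comp.
apply: (IHn) => //; apply: Ck_pair => //.
exact: (IHn _ _ _ _ _ (CkS Cg) (Ck_fst _ _ _)).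
Qed.

Lemma CkD (R : realType) (n : nat) (Y U : normedModType R) (f g : Y -> U) :
  Ck n f -> Ck n g -> Ck n (fun y => f y + g y).
Proof.
move=> Cf Cg; apply: (Ck_comp (f := fun p : U * U => p.1 + p.2)
  (g := fun y => (f y, g y))).
  apply: Ck_linear; last exact: add_continuous.
  by move=> a p q; rewrite /= scalerDr addrACA.
exact: Ck_pair.
Qed.

Lemma CkZ (R : realType) (n : nat) (Y U : normedModType R) (k : Y -> R)
    (f : Y -> U) :
  Ck n k -> Ck n f -> Ck n (fun y => k y *: f y).
Proof.
elim: n Y U k f => [|n IHn] Y U k f Ckk Cf.
  by move=> y; apply: cvgZ; [exact: Ckk|exact: Cf].
have [[kd Cdk] [fd Cdf]] := (Ckk, Cf).
have kfd y := is_diff_scalef (differentiableP (kd y)) (differentiableP (fd y)).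
split; first by move=> y; exact: (@ex_diff _ _ _ _ _ _ _ (kfd y)).
have -> : (fun p : Y * Y => 'd (fun y => k y *: f y) (p.1) p.2) =
    (fun p => k p.1 *: 'd f (p.1) p.2 + 'd k (p.1) p.2 *: f p.1).
  by apply/funext => p; rewrite (@diff_val _ _ _ _ _ _ _ (kfd p.1)).
apply: CkD; apply: IHn => //.
  exact: (Ck_comp (CkS Ckk) (Ck_fst _ _ _)).
exact: (Ck_comp (CkS Cf) (Ck_fst _ _ _)).
Qed.

(* With [u(s) = f(x + h w + s h v) - f(x + s h v)], the mean value inequality
   bounds [u(1) - u(0)], and, applied once more to [f'(.) v] in the direction
   [w], it bounds [u'(s)]. *)
Lemma second_difference (R : realType) (Y U : normedModType R) (f : Y -> U)
    (x v w : Y) (e : R) :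
  Ck 2 f -> 0 < e ->
  \forall h \near (0 : R),
    `|f (x + h *: w + h *: v) - f (x + h *: v) - (f (x + h *: w) - f x)
      - h ^+ 2 *: 'd (fun p : Y * Y => 'd f (p.1) p.2) (x, v) (w, 0)|
    <= h ^+ 2 * e.
Proof.
move=> [fd [Fd Fc]] e0; set F := (fun p : Y * Y => 'd f (p.1) p.2) in Fd Fc *.
have FE p : F p = 'd f (p.1) p.2 by [].
move: F FE Fd Fc => F FE Fd Fc; set D := 'd F (x, v) (w, 0).
have dFc : (fun z => 'd F (z, v) (w, 0)) @ x --> D.
  apply: (continuous_comp (f := fun z : Y => ((z, v), (w, 0 : Y)))
    (g := fun q => 'd F (q.1) q.2)); last exact: Fc.
  have zC : Ck 0 (fun z : Y => ((z, v), (w, 0 : Y))).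
    by do 2?[apply: (@Ck_pair _ 0)]; try exact: (@Ck_cst _ 0);
      move=> z; exact: cvg_id.
  exact: zC.
have /cvgr_distC_le/(_ e e0)/nbhs_normP[d /= d0 dP] := dFc.
(* For [s] and [r] in the unit interval, [|h| * m] bounds the displacement [s h v + r h w]; the
   summand [1] makes [m] positive. *)
pose m := `|v| + `|w| + 1.
have m0 : 0 < m by rewrite ltr_wpDl // addr_ge0.
apply/nbhs_normP; exists (d / m); first by rewrite /= divr_gt0.
move=> h /=; rewrite sub0r normrN ltr_pdivlMr // => hd.
have near_x (s r : R) : 0 <= s <= 1 -> 0 <= r <= 1 ->
    `|'d F (x + s *: (h *: v) + r *: (h *: w), v) (w, 0) - D| <= e.
  move=> /andP[s0 s1] /andP[r0 r1]; apply: dP.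
  rewrite /= -addrA opprD addNKr normrN.
  apply: le_lt_trans hd; rewrite (le_trans (ler_normD _ _)) // /m.
  rewrite !normrZ (ger0_norm s0) (ger0_norm r0) !mulrDr mulr1.
  by rewrite ler_wpDr // lerD // ler_piMl // mulr_ge0.
(* Subtracting the linear term makes [g 1 - g 0] exactly the quantity to be bounded. *)
pose g s := f (x + h *: w + s *: (h *: v)) - f (x + s *: (h *: v))
  - s *: (h ^+ 2 *: D).
pose dg s := h *: ('d f (x + h *: w + s *: (h *: v)) v
  - 'd f (x + s *: (h *: v)) v - h *: D).
have gd s : is_diff s g (fun k => k *: dg s).
  apply: is_diff_eq; first exact: (is_diffB (is_diffB (is_diff_line
    (fd (x + h *: w + s *: (h *: v)))) (is_diff_line (fd (x + s *: (h *: v)))))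
    (is_diff_scalel s (h ^+ 2 *: D))).
  have dfZ z : 'd f z (h *: v) = h *: 'd f z v by rewrite linearZ.
  apply/funext => k; rewrite !fctE /= !dfZ /dg expr2 -scalerA.
  by rewrite -!scalerBr.
have dg_le s : 0 <= s <= 1 -> `|dg s| <= h ^+ 2 * e.
  have -> : h ^+ 2 * e = `|h| * (`|h| * e).
    by rewrite mulrA -normrM ger0_norm -?expr2 ?sqr_ge0.
  move=> s01; rewrite /dg normrZ ler_wpM2l //.
  (* The segment moves only the base point, in the direction [h w]; this second application supplies
     the other factor [|h|]. *)
  pose k r := F ((x + s *: (h *: v), v) + r *: (h *: w, 0)) - r *: (h *: D).
  pose dk r := h *: ('d F (x + s *: (h *: v) + r *: (h *: w), v) (w, 0) - D).
  have kd r : is_diff r k (fun l => l *: dk r).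
    apply: (is_diff_eq (is_diffB (is_diff_line (Fd _)) (is_diff_scalel _ _))).
    have dFZ z : 'd F z (h *: w, 0 : Y) = h *: 'd F z (w, 0).
      by rewrite -linearZ /=; congr ('d F _ _); congr pair; rewrite scaler0.
    have -> : (x + s *: (h *: v), v) + r *: (h *: w, 0 : Y) =
        (x + s *: (h *: v) + r *: (h *: w), v).
      by apply: injective_projections; rewrite /= ?scaler0 ?addr0.
    by apply/funext => l; rewrite !fctE dFZ /dk -!scalerBr.
  have -> : 'd f (x + h *: w + s *: (h *: v)) v - 'd f (x + s *: (h *: v)) v
      - h *: D = k 1 - k 0.
    rewrite /k !scale1r !scale0r subr0 addr0 !FE /= addr0 [RHS]addrAC.
    by rewrite [x + h *: w + _]addrAC.
  apply: (mean_value_inequality kd) => r r01.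
  by rewrite /dk normrZ ler_wpM2l // near_x.
have := @mean_value_inequality _ _ g dg (h ^+ 2 * e) gd dg_le.
congr (`|_| <= _); rewrite /g !scale1r !scale0r !addr0 subr0.
by rewrite addrAC.
Qed.

(** The second difference is symmetric in [v] and [w], and divided by [h ^+ 2] it approximates both
    sides within [e / 2] for small [h]. *)
Lemma second_derivative_symmetric (R : realType) (Y U : normedModType R)
    (f : Y -> U) (x v w : Y) :
  Ck 2 f ->
  'd (fun p : Y * Y => 'd f (p.1) p.2) (x, v) (w, 0) =
  'd (fun p : Y * Y => 'd f (p.1) p.2) (x, w) (v, 0).
Proof.
move=> Cf; apply/eqP; rewrite -subr_eq0 -normr_le0; apply/ler_addgt0Pr => e e0.
rewrite add0r; have e20 : 0 < e / 2 by rewrite divr_gt0.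
have := second_difference x w v Cf e20; have := second_difference x v w Cf e20.
set A := 'd _ (x, v) _; set B := 'd _ (x, w) _.
move=> /nbhs_normP[d1 /= d10 H1] /nbhs_normP[d2 /= d20 H2].
pose d := Num.min d1 d2; have d0 : 0 < d by rewrite lt_min d10.
pose h := d / 2; have h0 : 0 < h by rewrite divr_gt0.
have : h < d by rewrite ltr_pdivrMr // mulr2n mulrDr mulr1 ltrDl.
rewrite lt_min => /andP[hd1 hd2].
have := H1 h; rewrite /= sub0r normrN gtr0_norm // => /(_ hd1) HA.
have := H2 h; rewrite /= sub0r normrN gtr0_norm // => /(_ hd2) HB.
have h2 : 0 < h ^+ 2 by rewrite exprn_gt0.
rewrite -(ler_pM2l h2) -[X in X * `|_|]gtr0_norm // -normrZ.
rewrite [e]splitr mulrDr; apply: le_trans (lerD HA HB).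
rewrite -[X in _ <= X + _]normrN; apply: le_trans (ler_normD _ _).
rewrite [x + h *: v + h *: w]addrAC.
set a := f _; set b := f _; set c := f _.
have <- : a - b - (c - f x) = a - c - (b - f x).
  by rewrite !opprB !addrA [LHS]addrAC [a - b - c]addrAC [LHS]addrAC.
by rewrite opprB subrKA scalerBr.
Qed.

Lemma is_diff_near_eq (R : realType) (V W : normedModType R) (f g df : V -> W)
    (x : V) :
  (\forall y \near x, g y = f y) -> is_diff x f df -> is_diff x g df.
Proof.
move=> fg dfx; have dfE : 'd f x = df :> (V -> W) by exact: diff_val.
have fd : differentiable f x by exact: ex_diff.
apply: is_diffP.
- by move=> a u v; rewrite -dfE linearP.
- by rewrite -dfE; exact: diff_continuous.
move=> e e0; have xc : (fun h : V => x + h) @ (0 : V) --> x.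
  by rewrite -[X in _ --> X]addr0; apply: cvgD; [exact: cvg_cst|exact: cvg_id].
have gx : g x = f x by exact: nbhs_singleton fg.
move: (is_diff_bound dfx e0) (xc _ fg); apply: filterS2 => h.
by move=> + /= ->; rewrite gx.
Qed.

(** Rescaling by [t], of either sign, reduces this to the unit interval; the chain rule supplies the
    factor [|t|]. *)
Lemma mean_value_inequality0 (R : realType) (V : normedModType R)
    (u du : R -> V) (M t : R) :
  (forall s, is_diff s u (fun h => h *: du s)) ->
  (forall s, `|s| <= `|t| -> `|du s| <= M) ->
  `|u t - u 0| <= `|t| * M.
Proof.
move=> ud duM.
have ut s : is_diff s (fun r : R => u (0 + r *: t))
    (fun h => h *: (t *: du (s *: t))).
  have dus := ud (0 + s *: t).
  apply: (is_diff_eq (is_diff_line (ex_diff (is_diff_def := dus)))).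
  by apply/funext => h; rewrite diff_val add0r.
have := @mean_value_inequality _ _ _ _ (`|t| * M) ut.
rewrite scale1r scale0r !add0r; apply=> s /andP[s0 s1].
rewrite normrZ ler_wpM2l // duM // normrZ ger0_norm //.
by rewrite ler_piMl.
Qed.

(** The linearization error is [p.2] times the increment of [q], so continuity of [q] suffices. With
    [q] a Taylor quotient this gives differentiability on the slice [t = 0]. *)
Lemma is_diff_snd_scale (R : realType) (X U : normedModType R) (q : X * R -> U)
    (x : X) :
  {for (x, 0), continuous q} ->
  is_diff (x, 0) (fun p : X * R => p.2 *: q p) (fun v => v.2 *: q (x, 0)).
Proof.
move=> qc; apply: is_diffP.
- by move=> a u v; rewrite /= scalerDl scalerA.
- by move=> v; apply: cvgZ; [exact: cvg_snd|exact: cvg_cst].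
move=> e e0.
have xc : (fun h : X * R => (x, 0) + h) @ (0 : X * R) --> (x, 0 : R).
  by rewrite -[X in _ --> X]addr0; apply: cvgD; [exact: cvg_cst|exact: cvg_id].
have /cvgr_distC_le/(_ e e0) qe := qc.
have near_q : \forall h \near (0 : X * R), `|q ((x, 0) + h) - q (x, 0)| <= e.
  exact: (xc _ qe).
apply: filterS near_q => h qhe.
rewrite /= add0r scale0r subr0 -scalerBr normrZ mulrC.
apply: ler_pM => //.
by rewrite prod_normE num_le_max lexx orbT.
Qed.

(** * Taylor quotients *)

Definition dt (R : realType) (X U : normedModType R) (G : X * R -> U)
  (p : X * R) : U := 'd G p (0, 1).

(** The direction joins the base point in [X * X], so [dx G] again has the form of [G] and the
    construction iterates. *)
Definition dx (R : realType) (X U : normedModType R) (G : X * R -> U)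
  (q : X * X * R) : U := 'd G (q.1.1, q.2) (q.1.2, 0).

Definition taylor_coef (R : realType) (X U : normedModType R) (G : X * R -> U)
  (k : nat) (x : X) : U := k`!%:R^-1 *: iter k (@dt R X U) G (x, 0).

Definition taylor_rem (R : realType) (X U : normedModType R) (G : X * R -> U)
    (k : nat) (p : X * R) : U :=
  G p - \sum_(j < k) p.2 ^+ j *: taylor_coef G j p.1.

Definition taylor_quot (R : realType) (X U : normedModType R) (G : X * R -> U)
    (k : nat) (p : X * R) : U :=
  if p.2 == 0 then taylor_coef G k p.1 else p.2 ^- k *: taylor_rem G k p.

Lemma smooth_dt (R : realType) (X U : normedModType R) (G : X * R -> U) :
  smooth G -> smooth (dt G).
Proof.
move=> sG n; apply: (Ck_comp (f := fun p => 'd G (p.1) p.2)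
  (g := fun p : X * R => (p, (0, 1)))); first exact: smooth_diff.
by apply: Ck_pair; [apply: Ck_linear => // p; exact: cvg_id|exact: Ck_cst].
Qed.

Lemma Ck_dx_arg (R : realType) (n : nat) (X : normedModType R) :
  Ck n (fun q : X * X * R => ((q.1.1, q.2), (q.1.2, 0 : R))).
Proof.
have C1 : Ck n (fun q : X * X * R => q.1) by exact: Ck_fst.
by do 2?[apply: Ck_pair]; [exact: (Ck_comp (Ck_fst _ _ _) C1)|exact: Ck_snd|
  exact: (Ck_comp (Ck_snd _ _ _) C1)|exact: Ck_cst].
Qed.

Lemma smooth_dx (R : realType) (X U : normedModType R) (G : X * R -> U) :
  smooth G -> smooth (dx G).
Proof.
move=> sG n; apply: (Ck_comp (f := fun p => 'd G (p.1) p.2)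
  (g := fun q : X * X * R => ((q.1.1, q.2), (q.1.2, 0 : R)))).
  exact: smooth_diff.
exact: Ck_dx_arg.
Qed.

Lemma smooth_iter_dt (R : realType) (X U : normedModType R) (G : X * R -> U)
    (k : nat) :
  smooth G -> smooth (iter k (@dt R X U) G).
Proof. by move=> sG; elim: k => //= k; exact: smooth_dt. Qed.

Lemma smooth_taylor_coef (R : realType) (X U : normedModType R)
    (G : X * R -> U) (k : nat) :
  smooth G -> smooth (taylor_coef G k).
Proof.
move=> sG n; apply: CkZ; first exact: Ck_cst.
apply: (Ck_comp (g := fun x : X => (x, 0 : R))); first exact: smooth_iter_dt.
by apply: Ck_pair; [apply: Ck_linear => // p; exact: cvg_id|exact: Ck_cst].
Qed.

(** * Mixed derivatives, Taylor coefficients and remainders *)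

Lemma is_diff_dt (R : realType) (X U : normedModType R) (G : X * R -> U)
    (p : X * R) :
  smooth G ->
  is_diff p (dt G) (fun v =>
    'd (fun q : (X * R) * (X * R) => 'd G (q.1) q.2)
      (p, (0 : X, 1 : R)) (v, 0)).
Proof.
move=> sG.
have dF := differentiableP (smooth_differentiable (p, (0 : X, 1 : R))
  (smooth_diff sG)).
have d1 : is_diff p (fun q : X * R => (q, (0 : X, 1 : R))) (fun q => (q, 0)).
  exact: (is_diff_pair (is_diff_id _) (is_diff_cst _ _)).
exact: (is_diff_comp d1 dF).
Qed.

Lemma is_diff_dx (R : realType) (X U : normedModType R) (G : X * R -> U)
    (q : X * X * R) :
  smooth G ->
  is_diff q (dx G) (fun r =>
    'd (fun p : (X * R) * (X * R) => 'd G (p.1) p.2)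
      ((q.1.1, q.2), (q.1.2, 0 : R)) ((r.1.1, r.2), (r.1.2, 0))).
Proof.
move=> sG.
have dF := differentiableP (smooth_differentiable
  ((q.1.1, q.2), (q.1.2, 0 : R)) (smooth_diff sG)).
have d2 : is_diff q (fun q : X * X * R => ((q.1.1, q.2), (q.1.2, 0 : R)))
    (fun q => ((q.1.1, q.2), (q.1.2, 0))).
  apply: is_diff_linear; last exact: (@Ck_dx_arg _ 0).
  move=> a p r; rewrite /=; congr ((_, _), (_, _)).
  by rewrite [RHS]addr0 [RHS]mulr0.
exact: (is_diff_comp d2 dF).
Qed.

(** Both sides are second derivatives of [G] at one point in the directions [(0, 1)] and
    [(q.1.2, 0)], taken in opposite orders. *)
Lemma dx_dt (R : realType) (X U : normedModType R) (G : X * R -> U) :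
  smooth G -> dx (dt G) = dt (dx G).
Proof.
move=> sG; apply/funext => q.
rewrite [LHS]/dx [RHS]/dt.
rewrite (@diff_val _ _ _ _ _ _ _ (is_diff_dt (q.1.1, q.2) sG)).
rewrite (@diff_val _ _ _ _ _ _ _ (is_diff_dx q sG)) /=.
exact: (@second_derivative_symmetric _ _ _ G).
Qed.

Lemma dx_iter_dt (R : realType) (X U : normedModType R) (G : X * R -> U)
    (k : nat) :
  smooth G -> dx (iter k (@dt R X U) G) = iter k (@dt _ _ _) (dx G).
Proof.
move=> sG; elim: k => //= k <-; apply: dx_dt; exact: smooth_iter_dt.
Qed.

Lemma is_diff_taylor_coef (R : realType) (X U : normedModType R)
    (G : X * R -> U) (k : nat) (x : X) :
  smooth G ->
  is_diff x (taylor_coef G k) (fun v => taylor_coef (dx G) k (x, v)).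
Proof.
move=> sG; rewrite /taylor_coef -dx_iter_dt //.
have sH := smooth_iter_dt k sG; set H := iter k _ G in sH *.
have d1 : is_diff x (fun y : X => (y, 0 : R)) (fun y => (y, 0)).
  exact: (is_diff_pair (is_diff_id _) (is_diff_cst _ _)).
have dH := differentiableP (smooth_differentiable (x, 0) sH).
exact: (is_diffZ _ (is_diff_comp d1 dH)).
Qed.

Lemma taylor_coef_dt (R : realType) (X U : normedModType R) (G : X * R -> U)
    (k : nat) (x : X) :
  taylor_coef (dt G) k x = k.+1%:R *: taylor_coef G k.+1 x.
Proof.
rewrite /taylor_coef iterSr scalerA factS natrM invfM mulrA.
by rewrite divff ?mul1r // pnatr_eq0.
Qed.

Lemma taylor_remS (R : realType) (X U : normedModType R) (G : X * R -> U)
    (k : nat) (p : X * R) :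
  taylor_rem G k.+1 p = taylor_rem G k p - p.2 ^+ k *: taylor_coef G k p.1.
Proof. by rewrite /taylor_rem big_ord_recr /= opprD addrA. Qed.

Lemma taylor_coef0 (R : realType) (X U : normedModType R) (G : X * R -> U)
    (x : X) :
  taylor_coef G 0 x = G (x, 0).
Proof. by rewrite /taylor_coef fact0 invr1 scale1r. Qed.

Lemma taylor_quot_at0 (R : realType) (X U : normedModType R) (G : X * R -> U)
    (k : nat) (x : X) :
  taylor_quot G k (x, 0) = taylor_coef G k x.
Proof. by rewrite /taylor_quot eqxx. Qed.

Lemma taylor_quot0 (R : realType) (X U : normedModType R) (G : X * R -> U) :
  taylor_quot G 0 = G.
Proof.
apply/funext => -[x t]; rewrite /taylor_quot /taylor_rem big_ord0 subr0 /=.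
by case: eqP => [->|_]; rewrite ?taylor_coef0 // invr1 scale1r.
Qed.

Lemma taylor_remE (R : realType) (X U : normedModType R) (G : X * R -> U)
    (k : nat) (p : X * R) :
  taylor_rem G k p = p.2 ^+ k *: taylor_quot G k p.
Proof.
case: p => x t; rewrite /taylor_quot /=; case: eqP => [->|/eqP t0].
  (* Here [0 ^+ 0 = 1] matters: for [k = 0] both sides are [G (x, 0)], and for larger [k] both
     vanish. *)
  elim: k => [|k IHk].
    by rewrite /taylor_rem big_ord0 subr0 scale1r taylor_coef0.
  by rewrite taylor_remS IHk /= subrr exprS mul0r scale0r.
by rewrite scalerA divff ?scale1r // expf_neq0.
Qed.

Lemma taylor_quotS (R : realType) (X U : normedModType R) (G : X * R -> U)
    (k : nat) (p : X * R) :
  taylor_quot G k p = taylor_coef G k p.1 + p.2 *: taylor_quot G k.+1 p.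
Proof.
case: p => x t; rewrite /= /taylor_quot /=; case: eqP => [->|/eqP t0].
  by rewrite scale0r addr0.
rewrite taylor_remS /=; move: (taylor_rem G k _) (taylor_coef G k x) => r c.
rewrite scalerA exprS invfM mulrA divff // mul1r scalerBr scalerA.
by rewrite mulVf ?expf_neq0 // scale1r subrKC.
Qed.

Lemma is_diff_exprS_scale (R : realType) (U : normedModType R) (k : nat)
    (c : U) (t : R) :
  is_diff t (fun s : R => s ^+ k.+1 *: c)
    (fun h => h *: (t ^+ k *: (k.+1%:R *: c))).
Proof.
have dX : is_diff t (fun s : R => s ^+ k.+1) (fun h => k.+1%:R * t ^+ k * h).
  have -> : (fun s : R => s ^+ k.+1) = id ^+ k.+1 by rewrite exprfctE.
  exact: (is_diff_eq (is_diffX k (is_diff_id t))).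
apply: (is_diff_eq (is_diff_scalef dX (is_diff_cst c t))).
apply/funext => h; rewrite [X in X + _]scaler0 add0r /= !scalerA.
by rewrite [_ * h]mulrC -mulrA [t ^+ k * _]mulrC.
Qed.

Lemma pair_snd_line (R : realType) (X : normedModType R) (x : X) (s t : R) :
  (x, t) + s *: (0, 1) = (x, t + s).
Proof.
apply: injective_projections; rewrite /= ?scaler0 ?addr0 //.
by congr (_ + _); exact: mulr1.
Qed.

(** The constant term drops out, and the factor [j + 1] from differentiating [t ^+ j.+1] turns
    coefficient [j + 1] of [G] into coefficient [j] of [dt G]. *)
Lemma is_diff_taylor_rem (R : realType) (X U : normedModType R)
    (G : X * R -> U) (k : nat) (x : X) (t : R) :
  smooth G ->
  is_diff t (fun s : R => taylor_rem G k.+1 (x, s))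
    (fun h => h *: taylor_rem (dt G) k (x, t)).
Proof.
move=> sG; elim: k => [|k IHk].
  have -> : (fun s : R => taylor_rem G 1 (x, s)) =
      (fun s => G ((x, 0) + s *: (0, 1))) - cst (taylor_coef G 0 x).
    apply/funext => s.
    rewrite taylor_remS /taylor_rem big_ord0 subr0 scale1r /=.
    by rewrite !fctE pair_snd_line add0r.
  have Gd p : differentiable G p by exact: smooth_differentiable.
  apply: (is_diff_eq (is_diffB (is_diff_line (Gd _)) (is_diff_cst _ _))).
  apply/funext => h; rewrite !fctE subr0 /taylor_rem big_ord0 subr0 /dt.
  by rewrite pair_snd_line add0r.
have -> : (fun s : R => taylor_rem G k.+2 (x, s)) =
    (fun s => taylor_rem G k.+1 (x, s)) -
    (fun s => s ^+ k.+1 *: taylor_coef G k.+1 x).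
  by apply/funext => s; rewrite taylor_remS !fctE.
apply: (is_diff_eq (is_diffB IHk (is_diff_exprS_scale k _ t))).
by apply/funext => h; rewrite !fctE taylor_remS taylor_coef_dt [RHS]scalerBr.
Qed.

(* [(d/dt) taylor_rem G k.+1 = taylor_rem (dt G) k], so the mean value
   inequality divides an estimate on [taylor_quot (dt G) k] by one more [t]. *)
Lemma taylor_quot_cvg0 (R : realType) (X U : normedModType R)
    (G : X * R -> U) (k : nat) (x : X) :
  smooth G -> taylor_quot G k @ (x, 0 : R) --> taylor_coef G k x.
Proof.
elim: k G => [|k IHk] G sG.
  by rewrite taylor_quot0 taylor_coef0; exact: smooth_continuous.
set c := taylor_coef G k.+1 x.
apply/cvgrPdist_le => e e0.
have cc : (fun p : X * R => taylor_coef G k.+1 p.1) @ (x, 0 : R) --> c.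
  apply: (continuous_comp (f := fst)); first exact: cvg_fst.
  by have /smooth_continuous := smooth_taylor_coef k.+1 sG; exact.
have /cvgrPdist_le/(_ e e0) near_c := cc.
have := IHk (dt G) (smooth_dt sG).
rewrite taylor_coef_dt -/c => Qc.
have /cvgr_distC_le/(_ e e0)/nbhs_normP[d /= d0 dQ] := Qc.
have near_d : \forall p \near (x, 0 : R), `|(x, 0) - p| < d.
  by apply/nbhs_normP; exists d.
apply: filterS2 near_c near_d => -[y t] /= yc ytd.
have [->|t0] := eqVneq t 0; first by rewrite taylor_quot_at0.
have tk0 : 0 < `|t| ^+ k.+1 by rewrite exprn_gt0 // normr_gt0.
rewrite -(ler_pM2l tk0) -normrX -normrZ scalerBr distrC.
(* [c] is taken at [x], not at [y], so [dw] measures how far [taylor_quot (dt G) k] is from its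
   limit at [(x, 0)]. In the max norm every [(y, s)] with [|s| <= |t|] stays in the ball. *)
pose w s := taylor_rem G k.+1 (y, s) - s ^+ k.+1 *: c.
pose dw s := s ^+ k *: (taylor_quot (dt G) k (y, s) - k.+1%:R *: c).
have wd s : is_diff s w (fun h => h *: dw s).
  have -> : w = (fun s => taylor_rem G k.+1 (y, s)) -
      (fun s => s ^+ k.+1 *: c) by [].
  apply: (is_diff_eq (is_diffB (is_diff_taylor_rem k y s sG)
    (is_diff_exprS_scale k c s))).
  by apply/funext => h; rewrite !fctE taylor_remE /dw /= -!scalerBr.
have dw_le s : `|s| <= `|t| -> `|dw s| <= `|t| ^+ k * e.
  move=> st; rewrite /dw normrZ normrX ler_pM ?exprn_ge0 ?lerXn2r ?nnegrE //.
  apply: dQ; apply: le_lt_trans ytd.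
  by rewrite !prod_normE /= !sub0r !normrN ge_max !le_max lexx st orbT.
have := mean_value_inequality0 wd dw_le.
rewrite /w expr0n scale0r subr0 [taylor_rem _ _ (y, 0)]taylor_remE.
rewrite expr0n scale0r subr0 taylor_remE /=.
by rewrite [`|_ ^+ k.+1|]normrX [`|t| ^+ k.+1]exprS -mulrA.
Qed.

(** * Differentiability and smoothness of the Taylor quotients *)

Lemma is_diff_taylor_quot (R : realType) (X U : normedModType R)
    (G : X * R -> U) (k : nat) (p : X * R) :
  smooth G ->
  is_diff p (taylor_quot G k) (fun v =>
    taylor_quot (dx G) k ((p.1, v.1), p.2) +
    v.2 *: (taylor_quot (dt G) k p - k%:R *: taylor_quot G k.+1 p)).
Proof.
case: p => x t sG /=.
have [->|t0] := eqVneq t 0.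
  have -> : taylor_quot G k = (taylor_coef G k \o fst) +
      (fun p : X * R => p.2 *: taylor_quot G k.+1 p).
    by apply/funext => p; exact: taylor_quotS.
  have d1 : is_diff (x, 0 : R) (fst : X * R -> X) fst.
    by apply: is_diff_linear => // p; exact: cvg_fst.
  have d2 := is_diff_comp d1 (is_diff_taylor_coef k x sG).
  have Qc : {for (x, 0), continuous (taylor_quot G k.+1)}.
    by have := @taylor_quot_cvg0 _ _ _ G k.+1 x sG; rewrite -taylor_quot_at0.
  have d3 := is_diff_snd_scale Qc.
  apply: (is_diff_eq (is_diffD d2 d3)).
  apply/funext => v; rewrite !fctE /= !taylor_quot_at0 taylor_coef_dt.
  by rewrite -scalerBl -natr1 [k%:R + 1]addrC addrK scale1r.
(* Away from [t = 0] the recursion is solved for the next quotient, [(Q_k - c_k) / t], and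
   differentiated by the product rule. *)
elim: k => [|k IHk].
  rewrite !taylor_quot0; have Gd := smooth_differentiable (x, t) sG.
  apply: (is_diff_eq (differentiableP Gd)).
  apply/funext => -[v s]; rewrite /dx /dt /= scale0r subr0 -linearZ -linearD.
  by rewrite pair_snd_line add0r.
have near_t : \forall p \near (x, t), p.2 != 0.
  have /cvgr_dist_lt/(_ `|t|) : (snd : X * R -> R) @ (x, t) --> t.
    exact: cvg_snd.
  rewrite normr_gt0 => /(_ t0); apply: filterS => -[y s] /=.
  by apply: contraTneq => ->; rewrite subr0 ltxx.
have d1 : is_diff (x, t) (fst : X * R -> X) fst.
  by apply: is_diff_linear => // p; exact: cvg_fst.
have d2 := is_diff_comp d1 (is_diff_taylor_coef k x sG).
have d3 : is_diff (x, t) (fun p : X * R => p.2^-1) (fun v => - t ^- 2 * v.2).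
  have ds : is_diff (x, t) (snd : X * R -> R) snd.
    by apply: is_diff_linear => // p; exact: cvg_snd.
  have di : is_diff t (fun s : R => s^-1) (fun h => - t ^- 2 * h).
    by apply: DiffDef; [exact: differentiable_Rinv|exact: diff_Rinv].
  exact: (is_diff_comp ds di).
have d4 := is_diff_scalef d3 (is_diffB IHk d2).
have near_eq : \forall p \near (x, t), taylor_quot G k.+1 p =
    p.2^-1 *: (taylor_quot G k - (taylor_coef G k \o fst)) p.
  apply: filterS near_t => -[y s] /= s0.
  rewrite !fctE [taylor_quot G k _]taylor_quotS /= addrC addKr scalerA.
  by rewrite mulVf // scale1r.
apply: (is_diff_eq (is_diff_near_eq near_eq d4)).
apply/funext => -[v s]; rewrite !fctE /=.
(* Each quotient is expanded once by its recursion, so that the coefficients cancel and the powers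
   of [t] can be compared. *)
rewrite [taylor_quot (dx G) k _]taylor_quotS.
rewrite [taylor_quot (dt G) k _]taylor_quotS.
rewrite [taylor_quot G k _]taylor_quotS [taylor_quot G k.+1 _]taylor_quotS /=.
rewrite taylor_coef_dt.
move: (taylor_quot (dx G) k.+1 _) (taylor_quot (dt G) k.+1 _) => a b.
move: (taylor_quot G k.+2 _) (taylor_coef G k.+1 x) => d c1.
move: (taylor_coef (dx G) k _) (taylor_coef G k x) => c c0.
set Y := c1 + t *: d; set E := _ - k%:R *: Y.
have addKl (u w : U) : u + w - u = w by rewrite addrC addKr.
rewrite -[c + _ + _]addrA !addKl.
have -> : (- t ^- 2 * s) *: (t *: Y) = - ((t^-1 * s) *: Y).
  rewrite scalerA -scaleNr; congr (_ *: _).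
  by rewrite !mulNr mulrAC expr2 invfM divfK.
(* The term [Y], from differentiating [1 / t], raises the factor [k] to [k + 1]. The coefficient
   [c1] then cancels, leaving a factor [t] for the division. *)
have EY : E - Y = t *: (b - k.+1%:R *: d).
  rewrite /E -addrA -opprD -{2}[Y]scale1r -scalerDl natr1 /Y scalerDr opprD.
  by rewrite addrAC addrA subrr add0r addrC scalerBr !scalerA mulrC.
rewrite scalerDr !scalerA mulVf // scale1r -addrA -scalerBr EY scalerA.
by rewrite mulrAC mulVf // mul1r.
Qed.

(** The derivative consists of quotients of [dx G] on the larger space, of [dt G], and of order
    [k + 1]; hence the induction on [n] varies [X], [G] and [k]. *)
Lemma smooth_taylor_quot (R : realType) (X U : normedModType R)
    (G : X * R -> U) (k : nat) :
  smooth G -> smooth (taylor_quot G k).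
Proof.
move=> sG n; elim: n X G k sG => [|n IHn] X G k sG.
  move=> p; apply: differentiable_continuous.
  exact: (@ex_diff _ _ _ _ _ _ _ (is_diff_taylor_quot k p sG)).
split.
  by move=> p; exact: (@ex_diff _ _ _ _ _ _ _ (is_diff_taylor_quot k p sG)).
have -> : (fun p : (X * R) * (X * R) => 'd (taylor_quot G k) (p.1) p.2) =
    (fun p => (taylor_quot (dx G) k \o
        (fun p : (X * R) * (X * R) => ((p.1.1, p.2.1), p.1.2))) p +
      p.2.2 *: (((taylor_quot (dt G) k) \o fst) p +
        - k%:R *: (taylor_quot G k.+1 \o fst) p)).
  apply/funext => p.
  rewrite (@diff_val _ _ _ _ _ _ _ (is_diff_taylor_quot k p.1 sG)) /=.
  by rewrite scaleNr.
have C1 (Y V : normedModType R) := @Ck_fst R n Y V.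
have C2 (Y V : normedModType R) := @Ck_snd R n Y V.
apply: CkD.
  apply: Ck_comp; first exact/IHn/smooth_dx.
  apply: Ck_pair; last exact: (Ck_comp (C2 _ _) (C1 _ _)).
  by apply: Ck_pair; [exact: (Ck_comp (C1 _ _) (C1 _ _))|
    exact: (Ck_comp (C1 _ _) (C2 _ _))].
apply: CkZ; first exact: (Ck_comp (C2 _ _) (C2 _ _)).
apply: CkD; first by apply: Ck_comp => //; exact/IHn/smooth_dt.
by apply: CkZ; [exact: Ck_cst|apply: Ck_comp => //; exact: IHn].
Qed.

(** * Integrators *)

Lemma affine_equivariantE (R : realType) (Phi : integrator R)
    (Y U : completeNormedModType R) (f : vector_field Y) (g : vector_field U)
    (L : Y -> U) (b : U) (y : Y) :
  affine_equivariant Phi -> linear L -> continuous L ->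
  (forall z, L (f z) = g (L z + b)) ->
  L (Phi Y f y) + b = Phi U g (L y + b).
Proof.
move=> Phi_eq Llin Lc Lfg.
pose HL := GRing.isLinear.Build R Y U *:%R L Llin.
pose LL : {linear Y -> U} := HB.pack L HL.
pose A := AffineMap (linear_part := LL) b Lc.
have /(_ _)/(congr1 (@^~ y)) := Phi_eq Y U A f g.
by apply; apply/funext => z; exact: Lfg.
Qed.

(** * The difference quotient field, its slices and its suspension *)

Definition ray_map (R : realType) (Y : completeNormedModType R)
    (f : vector_field Y) (p : Y * Y * R) : Y := f (p.1.1 + p.2 *: p.1.2).

(** The map [q] of the overview; as a Taylor quotient of order one it is smooth also across
    [t = 0]. *)
Definition quotient_fun (R : realType) (Y : completeNormedModType R)
    (f : vector_field Y)
    (p : Y * Y * R) : Y :=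
  taylor_quot (ray_map f) 1 p.

Lemma smooth_ray_map (R : realType) (Y : completeNormedModType R)
    (f : vector_field Y) :
  smooth (ray_map f).
Proof.
move=> n; have C1 (V W : normedModType R) := @Ck_fst R n V W.
have C2 (V W : normedModType R) := @Ck_snd R n V W.
apply: (Ck_comp (f := f) (g := fun p : Y * Y * R => p.1.1 + p.2 *: p.1.2)).
  exact: field_smooth.
apply: CkD; first exact: (Ck_comp (C1 _ _) (C1 _ _)).
by apply: CkZ => //; exact: (Ck_comp (C2 _ _) (C1 _ _)).
Qed.

Lemma quotient_funE (R : realType) (Y : completeNormedModType R)
    (f : vector_field Y) (x : Y * Y) (t : R) :
  t != 0 -> quotient_fun f (x, t) = t^-1 *: (f (x.1 + t *: x.2) - f x.1).
Proof.
move=> t0; rewrite /quotient_fun /taylor_quot /= (negbTE t0) taylor_remS /=.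
rewrite /taylor_rem big_ord0 subr0 taylor_coef0 /ray_map /=.
by rewrite scale1r scale0r addr0.
Qed.

Lemma quotient_fun0 (R : realType) (Y : completeNormedModType R)
    (f : vector_field Y) (x : Y * Y) :
  quotient_fun f (x, 0) = 'd f (x.1) x.2.
Proof.
rewrite /quotient_fun taylor_quot_at0 /taylor_coef /= invr1 scale1r /dt.
have Gd p : differentiable (ray_map f) p.
  exact/smooth_differentiable/smooth_ray_map.
have fd y : differentiable f y by apply/smooth_differentiable/field_smooth.
have d1 := is_diff_line (s := 0) (x := (x, 0 : R)) (a := (0, 1)) (Gd _).
have d2 := is_diff_line (s := 0) (x := x.1) (a := x.2) (fd _).
(* One curve is read as a line in the domain of [ray_map f] and as a line in [Y]; its two
   derivatives must agree. *)
have E : (fun r : R => ray_map f ((x, 0) + r *: (0, 1))) =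
    (fun r => f (x.1 + r *: x.2)).
  by apply/funext => r; rewrite pair_snd_line add0r.
rewrite E in d1.
have := congr1 (@^~ 1) (etrans (esym (@diff_val _ _ _ _ _ _ _ d1))
  (@diff_val _ _ _ _ _ _ _ d2)).
by rewrite /= !scale1r !scale0r !addr0.
Qed.

Lemma smooth_slice (R : realType) (Y : completeNormedModType R)
    (f : vector_field Y) (t : R) :
  smooth (fun x : Y * Y => (f x.1, quotient_fun f (x, t))).
Proof.
move=> n; apply: Ck_pair.
  by apply: (Ck_comp (f := f)); [exact: field_smooth|exact: Ck_fst].
apply: (Ck_comp (f := quotient_fun f) (g := fun x : Y * Y => (x, t))).
  exact/smooth_taylor_quot/smooth_ray_map.
by apply: Ck_pair; [apply: Ck_linear => // p; exact: cvg_id|exact: Ck_cst].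
Qed.

Lemma smooth_suspension (R : realType) (Y : completeNormedModType R)
    (f : vector_field Y) :
  smooth (fun p : Y * Y * R => ((f p.1.1, quotient_fun f p), 0 : R)).
Proof.
move=> n; apply: Ck_pair; last exact: Ck_cst.
apply: Ck_pair; last exact/smooth_taylor_quot/smooth_ray_map.
apply: (Ck_comp (f := f) (g := fun p : Y * Y * R => p.1.1)).
  exact: field_smooth.
exact: (Ck_comp (Ck_fst _ _ _) (Ck_fst _ _ _)).
Qed.

Definition slice_field (R : realType) (Y : completeNormedModType R)
    (f : vector_field Y) (t : R) : vector_field (Y * Y)%type :=
  VectorField (smooth_slice f t).

Definition suspension_field (R : realType) (Y : completeNormedModType R)
    (f : vector_field Y) : vector_field (Y * Y * R)%type :=
  VectorField (smooth_suspension f).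


(** The embedding of the slice is affine with translation [(0, t)], and the zero last component of
    the suspension makes it a relation. Pointwise agreement of [g] lets the tangent field stand for
    the slice at [0]. *)
Lemma integrator_suspension (R : realType) (Phi : integrator R)
    (Y : completeNormedModType R) (f : vector_field Y)
    (g : vector_field (Y * Y)%type) (x : Y * Y) (t : R) :
  affine_equivariant Phi ->
  (forall z, g z = slice_field f t z) ->
  Phi _ (suspension_field f) (x, t) = (Phi _ g x, t).
Proof.
move=> Phi_eq gE.
pose L (z : Y * Y) : Y * Y * R := (z, 0).
have inj_pair z : L z + (0, t) = (z, t).
  by apply: injective_projections; rewrite /= ?addr0 ?add0r.
rewrite -[in LHS]inj_pair -(@affine_equivariantE _ _ _ _ g) ?inj_pair //.
- move=> a y z; rewrite /L.
  by apply: injective_projections; rewrite /= ?scaler0 ?addr0.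
- by apply: (@Ck_pair _ 0); [move=> z; exact: cvg_id|exact: (@Ck_cst _ 0)].
- by move=> z; rewrite inj_pair gE.
Qed.

Lemma integrator_ray (R : realType) (Phi : integrator R)
    (Y : completeNormedModType R) (f : vector_field Y)
    (g : vector_field (Y * Y)%type) (x : Y * Y) (t : R) :
  affine_equivariant Phi ->
  (forall z, f (z.1 + t *: z.2) = (g z).1 + t *: (g z).2) ->
  (Phi _ g x).1 + t *: (Phi _ g x).2 = Phi _ f (x.1 + t *: x.2).
Proof.
move=> Phi_eq gE.
pose L (z : Y * Y) : Y := z.1 + t *: z.2.
have := @affine_equivariantE _ Phi _ _ g f L 0 x Phi_eq.
rewrite !addr0; apply.
- move=> a y z; rewrite /L /= !scalerDr !scalerA [t * a]mulrC.
  by rewrite addrACA.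
- move=> z; apply: cvgD; first exact: cvg_fst.
  by apply: cvgZ; [exact: cvg_cst|exact: cvg_snd].
- by move=> z; rewrite addr0 /L gE.
Qed.

Theorem theorem2p12 (R : realType) (Phi : integrator R)
    (Phi_differentiable : forall (Y : completeNormedModType R)
       (f : vector_field Y) (y : Y), differentiable (Phi Y f) y)
    (Phi_equivariant : affine_equivariant Phi) :
  closed_under_differentiation Phi.
Proof.
move=> Y f y eta.
pose F := suspension_field f; pose x := (y, eta).
have slice0 z : tangent_field f z = slice_field f 0 z.
  by rewrite /= quotient_fun0.
have slice_ray t z : t != 0 ->
    f (z.1 + t *: z.2) = (slice_field f t z).1 + t *: (slice_field f t z).2.
  by move=> t0; rewrite /= quotient_funE // scalerA divff // scale1r subrKC.
(* At [t = 0] the ray relation is the first projection. *)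
have slice_fst (g : vector_field (Y * Y)%type) :
    (forall z, (g z).1 = f z.1) -> (Phi _ g x).1 = Phi _ f y.
  move=> gE; have := @integrator_ray _ _ _ f g x 0 Phi_equivariant.
  by rewrite !scale0r !addr0; apply=> z; rewrite !scale0r !addr0.
have FE0 := integrator_suspension x Phi_equivariant slice0.
pose q t := (Phi _ F (x, t)).1.2.
(* The first component is known to be [Phi _ f y], so the ray relation can be solved for the
   second. *)
have qE t : t != 0 -> q t = t^-1 *: (Phi _ f (t *: eta + y) - Phi _ f y).
  move=> t0; rewrite /q (@integrator_suspension _ _ _ f (slice_field f t)) //=.
  have := @integrator_ray _ _ _ f (slice_field f t) x t Phi_equivariant.
  move=> /(_ (fun z => slice_ray t z t0)) /=; rewrite [_ + y]addrC => <-.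
  by rewrite slice_fst // [X in X - _]addrC addrK scalerA mulVf // scale1r.
have qc : q t @[t --> (0 : R)^'] --> q 0.
  apply/continuous_withinNx.
  have Fc : {for (x, 0 : R), continuous (Phi _ F)}.
    exact/differentiable_continuous/Phi_differentiable.
  have xtc : {for (0 : R), continuous (fun t : R => (x, t))}.
    apply: (@Ck_pair _ 0 R (Y * Y)%type R (fun=> x) idfun).
      exact: (@Ck_cst _ 0).
    by move=> t; exact: cvg_id.
  have pc : continuous (fun p : Y * Y * R => p.1.2).
    exact: (Ck_comp (Ck_snd 0 _ _) (Ck_fst 0 _ _)).
  exact: (continuous_comp (continuous_comp xtc Fc) (pc _)).
(* On the punctured neighbourhood [q] is the difference quotient of [Phi Y f] at [y] in the
   direction [eta]. *)
have qd : q t @[t --> (0 : R)^'] --> 'd (Phi Y f) y eta.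
  rewrite -deriveE; last exact: Phi_differentiable.
  have := @diff_derivable _ _ _ _ _ eta (Phi_differentiable Y f y).
  move=> dc; apply: cvg_trans dc; apply: near_eq_cvg.
  near=> t; rewrite qE //=; near: t; exact: nbhs_dnbhs_neq.
have q0 : q 0 = 'd (Phi Y f) y eta by exact: cvg_unique qc qd.
rewrite [LHS]surjective_pairing slice_fst //; congr (_, _).
by rewrite -q0 /q FE0.
Unshelve. all: by end_near. Qed.
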